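(* Let $n\geq 3$, $A\in\mathbb{R}^{n\times n}$, and $c\in\mathbb{R}$. Then the set $\mathrm{SO}(n)\cap\{X\in\mathbb{R}^{n\times n}:\ \langle A,X\rangle=c\}$ is connected.
   Context: $\mathrm{SO}(n)=\{X\in\mathbb{R}^{n\times n}: X^\intercal X=I,\ \det(X)=1\}$, and $\langle A,X\rangle=\operatorname{tr}(A^\intercal X)$ is the trace inner product. Connectedness is with respect to the subspace topology from $\mathbb{R}^{n\times n}$; the empty set counts as connected. *)

(* Defs.v *)
From mathcomp Require Import all_boot all_order all_algebra.
From mathcomp Require Import all_classical all_reals all_analysis.

Set Implicit Arguments.
Unset Strict Implicit.
Unset Printing Implicit Defensive.

Import Order.TTheory GRing.Theory Num.Theory.
Import numFieldNormedType.Exports.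

Local Open Scope classical_set_scope.
Local Open Scope ring_scope.

(** A bare subset of ['M[R]_n], whose library topology is entrywise (product)
    convergence, i.e. the usual topology of R^(n x n). *)
Definition SO (R : realType) (n : nat) : set 'M[R]_n :=
  [set X | X^T *m X = 1%:M /\ \det X = 1].

Definition mxinner (R : realType) (n : nat) (A X : 'M[R]_n) : R :=
  \tr (A^T *m X).

(* Main.v *)
Require Import Defs.
From mathcomp Require Import all_boot all_order all_algebra.
From mathcomp Require Import all_classical all_reals all_analysis.
From mathcomp Require Import ring lra.

Import Order.TTheory GRing.Theory Num.Theory.
Import numFieldNormedType.Exports.

Local Open Scope classical_set_scope.
Local Open Scope ring_scope.

Set Implicit Arguments.
Unset Strict Implicit.
Unset Printing Implicit Defensive.

(** Write f(X) = <A, X>; replacing A by -A we may assume c >= 0. The proof is an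
    induction on n through the fibration X |-> X e0 of SO(n) over the sphere,
    whose fibers are copies of SO(n-1).

    Every superlevel set of f is connected: after a change of bases e0 is a
    top singular vector of A and f is nondecreasing along the rotation, in the
    plane of e0 and X e0, that brings X e0 back to e0; so the superlevel set is
    connected by paths to a superlevel set in SO(n-1).

    For the level set {f = c}, change bases instead so that e0 is a singular
    vector of A for the smallest singular value. Then f takes a value <= 0 on
    every fiber, so a fiber meets {f = c} as soon as it meets {f >= c}. Hence
    {f = c} has the same image in the sphere as {f >= c}, which is connected,
    and its fibers are level sets in SO(n-1). By compactness a set with
    connected fibers over a connected base is connected.

    For n = 3, unit quaternions turn f into a quadratic form on R^4, and any two
    points p, q of a projective quadric are joined inside it through a vector
    orthogonal to both for the form. *)

(** * Topology *)

Lemma connected_pairwise (T : topologicalType) (S : set T) (x0 : T) :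
  (forall x, S x -> exists C, [/\ connected C, C `<=` S, C x0 & C x]) ->
  connected S.
Proof.
move=> H.
pose F C := [/\ connected C, C `<=` S & C x0].
have -> : S = \bigcup_(C in F) C.
  apply/seteqP; split => [x /H [C [cC CS C0 Cx]]|x [C [_ CS _] /CS]//].
  by exists C.
apply: bigcup_connected; last by move=> C [].
by exists x0 => C [].
Qed.

Lemma connected_sub1 (T : topologicalType) (S : set T) (x0 : T) :
  S `<=` [set x0] -> connected S.
Proof.
move=> Sx0; apply: (@connected_pairwise _ _ x0) => x Sx.
exists [set x0]; split=> //; [exact: connected1| |exact: Sx0].
by move=> _ ->; rewrite -(Sx0 _ Sx).
Qed.

Lemma connected_image (T U : topologicalType) (f : T -> U) (A : set T) :
  connected A -> continuous f -> connected (f @` A).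
Proof.
move=> cA cf; apply: connected_continuous_connected => //.
exact: continuous_subspaceT.
Qed.

(** A nonempty relatively clopen [V] in [S] is a union of fibers, because each fiber is connected.
    By compactness the images of [V] and of its complement [W] in [S] are closed, so [f @]
    V[is clopen in the connected set]f @[S], and therefore all of it. *)
Lemma connected_fibers (T U : topologicalType) (f : T -> U) (S : set T) :
  hausdorff_space U -> continuous f -> compact S -> connected (f @` S) ->
  (forall y, connected (S `&` f @^-1` [set y])) -> connected S.
Proof.
move=> hU cf cS cfS fib V [x0 Vx0] [U0 oU0 VO] [C clC VC].
have VS : V `<=` S by rewrite VC => x [].
pose W := S `&` ~` U0.
have comp D : closed D -> closed (f @` (S `&` D)).
  move=> clD; apply: compact_closed => //; apply: continuous_compact.
    exact: continuous_subspaceT.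
  exact: compact_closedI.
have fibV x y : V x -> S y -> f x = f y -> V y.
  move=> Vx Sy fxy.
  have E : V `&` f @^-1` [set f x] = S `&` f @^-1` [set f x].
    apply: (fib (f x)).
    - by exists x.
    - by exists U0 => //; rewrite VO setIAC.
    - by exists C => //; rewrite VC setIAC.
  have : (S `&` f @^-1` [set f x]) y by split.
  by rewrite -E => -[].
have fV : f @` V = f @` S.
  apply: (cfS (f @` V)).
  - by exists (f x0), x0.
  (* Saturation makes the images of [V] and [W] disjoint, so removing the closed image of [W] leaves
     exactly the image of [V]. *)
  - exists (~` (f @` W)).
      by apply: closed_openC; apply: comp; exact: open_closedC.
    apply/seteqP; split => [_ [x Vx <-]|_ [[x Sx <-] nW]].
      split; first by exists x => //; exact: VS.
      move=> [y [Sy nU0y] fyx]; apply: nU0y.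
      by have : V y; [apply: (fibV x) => //; rewrite fyx|rewrite VO => -[]].
    exists x => //; rewrite VO; split => //.
    by apply: contrapT => nO; apply: nW; exists x.
  - exists (f @` V); first by rewrite VC; exact: comp.
    by apply/seteqP; split => [_ [x Vx <-]|y []//]; split; exists x => //; exact: VS.
apply/seteqP; split => // x Sx.
have [y Vy yx] : (f @` V) (f x) by rewrite fV; exists x.
exact: (fibV y).
Qed.

Lemma continuous_mx (T : topologicalType) (U : topologicalType) m n
    (f : T -> 'M[U]_(m, n)) :
  (forall i j, continuous (fun x => f x i j)) -> continuous f.
Proof.
move=> cf x B [P MP sPB].
have := @filter_forall T ('I_m * 'I_n)%type
  (fun ij => (fun x => f x ij.1 ij.2) @^-1` P ij.1 ij.2) (nbhs x) _.
move=> /(_ _ (fun ij => cf ij.1 ij.2 x _ (MP ij.1 ij.2))) H.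
by apply: filterS H => y Hy; apply: sPB => i j; exact: (Hy (i, j)).
Qed.

Lemma continuous_sum (R : realType) (T : topologicalType) (I : Type) (r : seq I)
    (P : pred I) (f : I -> T -> R) :
  (forall i, P i -> continuous (f i)) ->
  continuous (fun x => \sum_(i <- r | P i) f i x).
Proof. by apply: continuous_big; exact: add_continuous. Qed.

Lemma continuous_mul (R : realType) (T : topologicalType) (f g : T -> R) :
  continuous f -> continuous g -> continuous (fun x => f x * g x).
Proof. by move=> cf cg x; apply: cvgM; [exact: cf|exact: cg]. Qed.

Lemma continuous_add (R : realType) (T : topologicalType) (f g : T -> R) :
  continuous f -> continuous g -> continuous (fun x => f x + g x).
Proof. by move=> cf cg x; apply: cvgD; [exact: cf|exact: cg]. Qed.

Lemma mulmx_continuous (R : realType) (T : topologicalType) m n p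
    (f : T -> 'M[R]_(m, n)) (g : T -> 'M[R]_(n, p)) :
  continuous f -> continuous g -> continuous (fun x => f x *m g x).
Proof.
move=> cf cg; apply: continuous_mx => i j.
under eq_fun do rewrite mxE.
apply: continuous_sum => k _ x; apply: cvgM.
  exact: (continuous_comp (cf x) (@coord_continuous _ _ _ i k (f x))).
exact: (continuous_comp (cg x) (@coord_continuous _ _ _ k j (g x))).
Qed.

Lemma mxinner_continuous (R : realType) n (A : 'M[R]_n) : continuous (mxinner A).
Proof.
apply: continuous_sum => i _.
have c1 : continuous (fun X : 'M[R]_n => A^T *m X).
  by apply: (@mulmx_continuous R _ n n n (fun=> A^T) id) => x;
    [exact: cst_continuous|exact: cvg_id].
by move=> x; exact: (continuous_comp (c1 x) (@coord_continuous _ _ _ i i (A^T *m x))).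
Qed.

Lemma det_continuous (R : realType) n : continuous (fun X : 'M[R]_n => \det X).
Proof.
apply: continuous_sum => s _; apply: continuous_mul; first exact: cst_continuous.
by apply: continuous_big => [|i _]; [exact: mul_continuous|exact: coord_continuous].
Qed.

Lemma mx_hausdorff (R : realType) m n : hausdorff_space 'M[R]_(m, n).
Proof.
move=> p q pq; apply/matrixP => i j; apply: (@Rhausdorff R) => A B Ap Bq.
have [z [Az Bz]] := pq _ _ (@coord_continuous _ _ _ i j p _ Ap)
  (@coord_continuous _ _ _ i j q _ Bq).
by exists (z i j).
Qed.

(** The defining equations are closed, and unit columns confine the entries to [-1, 1]. The
    enclosing cube is built on row vectors, where [rV_compact] applies, and carried to matrices by
    [vec_mx]. *)
Lemma SO_compact (R : realType) n : compact (@SO R n).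
Proof.
pose box := [set v : 'rV[R]_(n * n) | forall i, v ord0 i \in `[(-1 : R), 1]].
have cbox : compact box.
  apply: (@rV_compact _ _ (fun=> `[(-1 : R), 1]%classic)).
  by move=> _; apply: segment_compact.
have cvec : continuous (@vec_mx R n n).
  apply: continuous_mx => i j; under eq_fun do rewrite mxE.
  exact: coord_continuous.
have cXX : continuous (fun X : 'M[R]_n => X^T *m X).
  apply: (@mulmx_continuous R _ n n n trmx id) => x; last exact: cvg_id.
  apply: continuous_mx => i j; under eq_fun do rewrite mxE.
  exact: coord_continuous.
apply: (@subclosed_compact _ _ (vec_mx @` box)).
- apply: closedI.
    have /continuous_closedP/(_ [set 1%:M]) := cXX; apply.
    by apply: compact_closed; [exact: mx_hausdorff|exact: compact_set1].
  have /continuous_closedP/(_ [set 1]) := @det_continuous R n; apply.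
  exact: closed_eq.
- by apply: continuous_compact => //; apply: continuous_subspaceT.
move=> X [XX _]; exists (mxvec X); last by rewrite mxvecK.
move=> k; case/mxvec_indexP: k => i j; rewrite mxvecE /= in_itv /=.
have : (X^T *m X) j j = 1 by rewrite XX mxE eqxx.
rewrite mxE (bigD1 i) //= !mxE => XXj.
have : 0 <= \sum_(k < n | k != i) X^T j k * X k j.
  by apply: sumr_ge0 => k _; rewrite mxE -expr2 sqr_ge0.
move=> h; have : X i j * X i j <= 1 by lra.
by nra.
Qed.

(** * Rotations *)

Section DotProduct.
Context {R : realType}.

Definition dot m (u v : 'cV[R]_m) : R := (u^T *m v) 0 0.

Lemma dotE m (u v : 'cV[R]_m) : u^T *m v = (dot u v)%:M.
Proof. by rewrite [LHS]mx11_scalar. Qed.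

Lemma dot_sum m (u v : 'cV[R]_m) : dot u v = \sum_i u i 0 * v i 0.
Proof. by rewrite /dot mxE; apply: eq_bigr => i _; rewrite mxE. Qed.

Lemma dotC m (u v : 'cV[R]_m) : dot u v = dot v u.
Proof. by rewrite !dot_sum; apply: eq_bigr => i _; rewrite mulrC. Qed.

Lemma dotDr m (u v w : 'cV[R]_m) : dot u (v + w) = dot u v + dot u w.
Proof. by rewrite /dot mulmxDr mxE. Qed.

Lemma dotZr m (u v : 'cV[R]_m) k : dot u (k *: v) = k * dot u v.
Proof. by rewrite /dot -scalemxAr mxE. Qed.

Lemma dotDl m (u v w : 'cV[R]_m) : dot (v + w) u = dot v u + dot w u.
Proof. by rewrite dotC dotDr !(dotC u). Qed.

Lemma dotZl m (u v : 'cV[R]_m) k : dot (k *: v) u = k * dot v u.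
Proof. by rewrite dotC dotZr dotC. Qed.

Lemma dot_mulr m n (A : 'M[R]_(m, n)) u v : dot u (A *m v) = dot (A^T *m u) v.
Proof. by rewrite /dot trmx_mul trmxK mulmxA. Qed.

Lemma dot_ge0 m (u : 'cV[R]_m) : 0 <= dot u u.
Proof. by rewrite dot_sum sumr_ge0 // => i _; rewrite -expr2 sqr_ge0. Qed.

Lemma dot_eq0 m (u : 'cV[R]_m) : dot u u = 0 -> u = 0.
Proof.
move/eqP; rewrite dot_sum psumr_eq0 => [/allP h|i _]; last first.
  by rewrite -expr2 sqr_ge0.
apply/matrixP => i j; rewrite ord1 mxE; apply/eqP.
by have := h i (mem_index_enum i); rewrite /= -expr2 sqrf_eq0.
Qed.

Lemma dot_col_mx m n (u u' : 'cV[R]_m) (v v' : 'cV[R]_n) :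
  dot (col_mx u v) (col_mx u' v') = dot u u' + dot v v'.
Proof. by rewrite /dot tr_col_mx mul_row_col mxE. Qed.

Lemma dot11 (x y : R) : dot x%:M y%:M = x * y.
Proof. by rewrite /dot tr_scalar_mx -scalar_mxM mxE eqxx. Qed.

Lemma dot0r m (u : 'cV[R]_m) : dot u 0 = 0.
Proof. by rewrite /dot mulmx0 mxE. Qed.

Lemma cauchy_schwarz m (u v : 'cV[R]_m) : dot u v ^+ 2 <= dot u u * dot v v.
Proof.
have [v0|v0] := eqVneq (dot v v) 0.
  by rewrite (dot_eq0 v0) !dot0r expr0n mulr0.
have v_gt0 : 0 < dot v v by rewrite lt_neqAle eq_sym v0 dot_ge0.
have := dot_ge0 (dot v v *: u - dot u v *: v).
rewrite -scaleNr !(dotDr, dotDl, dotZr, dotZl) (dotC v u) => h.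
have {}h : 0 <= dot v v * (dot u u * dot v v - dot u v ^+ 2) by lra.
by rewrite -subr_ge0; rewrite pmulr_rge0 in h.
Qed.

Lemma normalize m (v : 'cV[R]_m) : v != 0 ->
  exists r u, [/\ 0 < r, dot u u = 1 & v = r *: u].
Proof.
move=> v0; have vv : 0 < dot v v.
  by rewrite lt_neqAle dot_ge0 andbT eq_sym; apply: contra v0 => /eqP/dot_eq0 ->.
exists (Num.sqrt (dot v v)), ((Num.sqrt (dot v v))^-1 *: v); split.
- by rewrite sqrtr_gt0.
- rewrite dotZr dotZl mulrA -invfM -expr2 sqr_sqrtr ?dot_ge0 //.
  by rewrite mulVf // gt_eqF.
- by rewrite scalerA mulfV ?scale1r // gt_eqF // sqrtr_gt0.
Qed.

Lemma unit_vector m : exists u : 'cV[R]_m.+1, dot u u = 1.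
Proof.
exists (delta_mx 0 0); rewrite dot_sum (bigD1 0) //= big1 ?addr0 => [|i i0].
  by rewrite mxE !eqxx mulr1.
by rewrite mxE (negbTE i0) mul0r.
Qed.

Lemma orthogonal_unit_vector m (v : 'cV[R]_m.+2) :
  exists2 u : 'cV[R]_m.+2, dot u u = 1 & dot v u = 0.
Proof.
(* The rank of a column is at most 1 while its height here is at least 2, so a nonzero row
   annihilates it. *)
have /rowV0Pn[w /sub_kermxP w1 w0] : kermx v != 0.
  rewrite kermx_eq0; apply/negP => /eqP rv.
  by have := rank_leq_col v; rewrite rv.
have [|r [u [r0 u1 wu]]] := @normalize _ w^T.
  by rewrite -trmx0 (inj_eq trmx_inj).
have rn0 : r != 0 by rewrite gt_eqF.
exists u => //; apply: (mulfI rn0); rewrite -dotZr -wu.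
by rewrite dotC /dot trmxK w1 mxE mulr0.
Qed.

End DotProduct.

(** * The group SO(n) and its action on the sphere *)

Section SpecialOrthogonal.
Context {R : realType}.

Lemma SO_mulVr n (X : 'M[R]_n) : @SO R n X -> X *m X^T = 1%:M.
Proof. by case=> XX _; apply: mulmx1C. Qed.

Lemma SO1 n : @SO R n 1%:M.
Proof. by split; rewrite ?det1 // trmx1 mulmx1. Qed.

Lemma SO_mul n (X Y : 'M[R]_n) : @SO R n X -> @SO R n Y -> @SO R n (X *m Y).
Proof.
move=> [XX dX] [YY dY]; split; last by rewrite det_mulmx dX dY mulr1.
by rewrite trmx_mul mulmxA -(mulmxA _ X^T) XX mulmx1.
Qed.

Lemma SO_tr n (X : 'M[R]_n) : @SO R n X -> @SO R n X^T.
Proof. by move=> SX; split; rewrite ?trmxK ?SO_mulVr // det_tr; case: SX. Qed.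

Lemma mxinner_mull n (A P X : 'M[R]_n) : mxinner A (P *m X) = mxinner (P^T *m A) X.
Proof. by rewrite /mxinner trmx_mul trmxK mulmxA. Qed.

Lemma mxinner_mulr n (A X Q : 'M[R]_n) : mxinner A (X *m Q) = mxinner (A *m Q^T) X.
Proof. by rewrite /mxinner trmx_mul trmxK mulmxA mxtrace_mulC mulmxA. Qed.

Lemma mxinner_block m n (A : 'M[R]_(m + n)) (P : 'M[R]_m) (Q : 'M[R]_n) :
  mxinner A (block_mx P 0 0 Q) = mxinner (ulsubmx A) P + mxinner (drsubmx A) Q.
Proof.
rewrite /mxinner -{1}[A]submxK tr_block_mx mulmx_block !mulmx0 !add0r !addr0.
by rewrite mxtrace_block.
Qed.

(** This embeds SO(m) in SO(1 + m) as the stabilizer of [e0]; see [SO_fix_e0]. *)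
Definition ext m (Q : 'M[R]_m) : 'M[R]_(1 + m) := block_mx 1%:M 0 0 Q.

Lemma mxinner_ext m (A : 'M[R]_(1 + m)) Q :
  mxinner A (ext Q) = A 0 0 + mxinner (drsubmx A) Q.
Proof.
rewrite mxinner_block; congr (_ + _).
rewrite /mxinner mulmx1 mxtrace_tr trace_mx11 !mxE.
by congr (A _ _); apply/val_inj.
Qed.

Lemma SO_ext m (Q : 'M[R]_m) : @SO R m Q -> @SO R (1 + m) (ext Q).
Proof.
move=> [QQ dQ]; split; last by rewrite det_ublock det1 mul1r.
rewrite tr_block_mx mulmx_block !trmx0 trmx1 !mulmx0 !mul0mx !addr0 add0r QQ.
by rewrite mulmx1 -scalar_mx_block.
Qed.

Definition e0 m : 'cV[R]_(1 + m) := col_mx 1%:M 0.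

Lemma lsubmxE m (X : 'M[R]_(1 + m)) : lsubmx X = X *m e0 m.
Proof. by rewrite -{2}[X]hsubmxK mul_row_col mulmx1 mulmx0 addr0. Qed.

Lemma ext_e0 m (Q : 'M[R]_m) : ext Q *m e0 m = e0 m.
Proof. by rewrite mul_block_col !mulmx1 !mulmx0 !addr0. Qed.

Lemma dot_e0 m : dot (e0 m) (e0 m) = 1.
Proof. by rewrite dot_col_mx dot11 dot0r addr0 mulr1. Qed.

(** The first column is [e0], so its orthogonality to the other columns says that the rest of the
    first row vanishes. *)
Lemma SO_fix_e0 m (X : 'M[R]_(1 + m)) : @SO R (1 + m) X -> X *m e0 m = e0 m ->
  exists2 Q, @SO R m Q & X = ext Q.
Proof.
rewrite -lsubmxE => SX lX.
have [B [D EX]] : exists B D, X = block_mx 1%:M B 0 D.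
  exists (usubmx (rsubmx X)), (dsubmx (rsubmx X)).
  by rewrite block_mxEh vsubmxK -{1}[X]hsubmxK lX.
case: SX; rewrite {lX}EX tr_block_mx mulmx_block trmx1 trmx0 !mul1mx !mul0mx.
rewrite !addr0 (@scalar_mx_block _ 1 m) => /eq_block_mx[_ -> _].
by rewrite mulmx0 add0r det_ublock det1 mul1r => DD dD; exists D.
Qed.

(** For a unit vector [u] this is the rotation by the angle [t] from [e0] towards [(0, u)], the
    identity on the orthogonal complement of their plane. *)
Definition plane_rot m (t : R) (u : 'cV[R]_m) : 'M[R]_(1 + m) :=
  block_mx (cos t)%:M (- sin t *: u^T) (sin t *: u)
    (1%:M - (1 - cos t) *: (u *m u^T)).

Lemma plane_rotD m s t (u : 'cV[R]_m) : dot u u = 1 ->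
  plane_rot s u *m plane_rot t u = plane_rot (s + t) u.
Proof.
move=> u1; have uu : u^T *m u = 1%:M by rewrite dotE u1.
have uuu : u^T *m (u *m u^T) = u^T by rewrite mulmxA uu mul1mx.
have uuu' : u *m u^T *m u = u by rewrite -mulmxA uu mulmx1.
have uuuu : u *m u^T *m (u *m u^T) = u *m u^T by rewrite mulmxA uuu'.
rewrite mulmx_block /plane_rot cosD sinD.
rewrite !(mulmxBl, mulmxBr, mul1mx, mulmx1, mul_scalar_mx, mul_mx_scalar).
rewrite -!scalemxAl -!scalemxAr -?scalemxAl -?scalemxAr uuuu uuu uuu' uu.
rewrite !scalerA.
congr block_mx.
- by apply/matrixP => i j; rewrite !mxE; ring.
- by apply/matrixP => i j; rewrite !mxE; ring.
- by apply/matrixP => i j; rewrite !mxE; ring.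
- by apply/matrixP => i j; rewrite !mxE; ring.
Qed.

Lemma plane_rot0 m (u : 'cV[R]_m) : plane_rot 0 u = 1%:M.
Proof.
by rewrite /plane_rot cos0 sin0 oppr0 !scale0r subrr scale0r subr0 -scalar_mx_block.
Qed.

Lemma plane_rotN m t (u : 'cV[R]_m) : (plane_rot t u)^T = plane_rot (- t) u.
Proof.
rewrite /plane_rot tr_block_mx cosN sinN opprK tr_scalar_mx !linearZ /= trmxK.
by rewrite linearD /= trmx1 linearZ linearN /= trmx_mul trmxK.
Qed.

(* A rotation is the square of a rotation by half the angle, so its
   determinant is the square of +-1. *)
Lemma SO_plane_rot m t (u : 'cV[R]_m) : dot u u = 1 -> @SO R (1 + m) (plane_rot t u).
Proof.
move=> u1; have rr s : (plane_rot s u)^T *m plane_rot s u = 1%:M.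
  by rewrite plane_rotN plane_rotD // addNr plane_rot0.
split => //; rewrite [t]splitr -plane_rotD // det_mulmx.
by rewrite -{1}det_tr -det_mulmx rr det1.
Qed.

Lemma plane_rot_e0 m t (u : 'cV[R]_m) :
  plane_rot t u *m e0 m = col_mx (cos t)%:M (sin t *: u).
Proof. by rewrite mul_block_col !mulmx0 !addr0 !mulmx1. Qed.

Lemma unit_polar m (y : 'cV[R]_(1 + m.+1)) : dot y y = 1 ->
  exists t u, [/\ 0 <= t <= pi, dot u u = 1 & y = plane_rot t u *m e0 m.+1].
Proof.
rewrite -[y]vsubmxK [usubmx y]mx11_scalar; set a := usubmx y 0 0.
set v := dsubmx y; rewrite dot_col_mx dot11 => avv.
have v0 := dot_ge0 v.
have a1 : -1 <= a <= 1 by apply/andP; nra.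
have t0pi : 0 <= acos a <= pi by rewrite acos_ge0 // acos_lepi.
have ca : cos (acos a) = a by rewrite acosK // in_itv.
have [v_eq0|/normalize[r [u [r0 u1 vru]]]] := eqVneq v 0.
  (* At a pole [sin t] vanishes and any unit [u] serves. *)
  have [u u1] := @unit_vector R m; exists (acos a), u; split => //.
  have a2 : 1 - a ^+ 2 = 0 by move: avv; rewrite v_eq0 dot0r addr0 => <-; ring.
  by rewrite plane_rot_e0 ca v_eq0 sin_acos // a2 sqrtr0 scale0r.
exists (acos a), u; split => //.
rewrite plane_rot_e0 ca sin_acos // vru; congr col_mx; congr (_ *: _).
move: avv; rewrite vru dotZr dotZl u1 mulr1 => avv.
have -> : 1 - a ^+ 2 = r ^+ 2 by rewrite -avv; ring.
by rewrite sqrtr_sqr gtr0_norm.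
Qed.

Lemma SO_transitive m (y : 'cV[R]_(1 + m.+1)) : dot y y = 1 ->
  exists2 X, @SO R (1 + m.+1) X & X *m e0 _ = y.
Proof.
by move=> /unit_polar[t [u [_ u1 ->]]]; exists (plane_rot t u) => //;
  exact: SO_plane_rot.
Qed.

Lemma SO_dot n (X : 'M[R]_n) u v : @SO R n X -> dot (X *m u) (X *m v) = dot u v.
Proof. by move=> [XX _]; rewrite dot_mulr mulmxA XX mul1mx. Qed.

(** Rotating [X e0] back to [e0] leaves an element of the stabilizer. The angle is kept in [0, pi],
    where the cosine is decreasing. *)
Lemma SO_decomp m (X : 'M[R]_(1 + m.+1)) : @SO R (1 + m.+1) X ->
  exists t u Q, [/\ 0 <= t <= pi, dot u u = 1, @SO R m.+1 Q &
    X = plane_rot t u *m ext Q].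
Proof.
move=> SX.
have [|t [u [t0 u1 Xe]]] := @unit_polar m (X *m e0 m.+1).
  by rewrite SO_dot // dot_e0.
have Sr := SO_plane_rot t u1.
have [||Q SQ EQ] := @SO_fix_e0 m.+1 ((plane_rot t u)^T *m X).
- by apply: SO_mul => //; exact: SO_tr.
- by rewrite -mulmxA Xe mulmxA; case: Sr => -> _; rewrite mul1mx.
exists t, u, Q; split => //.
by rewrite -EQ mulmxA SO_mulVr // mul1mx.
Qed.

End SpecialOrthogonal.

(** * Continuity of matrix operations, and changes of bases *)

Section Continuity.
Context {R : realType}.

Lemma continuous_mulmxl m n p (A : 'M[R]_(m, n)) :
  continuous (fun X : 'M[R]_(n, p) => A *m X).
Proof.
by apply: (@mulmx_continuous R _ m n p (fun=> A) id) => x;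
  [exact: cst_continuous|exact: cvg_id].
Qed.

Lemma continuous_mulmxr m n p (A : 'M[R]_(n, p)) :
  continuous (fun X : 'M[R]_(m, n) => X *m A).
Proof.
by apply: (@mulmx_continuous R _ m n p id (fun=> A)) => x;
  [exact: cvg_id|exact: cst_continuous].
Qed.

Lemma continuous_block_mx (T : topologicalType) m1 m2 n1 n2
    (A : T -> 'M[R]_(m1, n1)) (B : T -> 'M[R]_(m1, n2))
    (C : T -> 'M[R]_(m2, n1)) (D : T -> 'M[R]_(m2, n2)) :
  continuous A -> continuous B -> continuous C -> continuous D ->
  continuous (fun x => block_mx (A x) (B x) (C x) (D x)).
Proof.
have coord m n i j (F : T -> 'M[R]_(m, n)) :
    continuous F -> continuous (fun x => F x i j).
  by move=> cF x; exact: (continuous_comp (cF x) (@coord_continuous _ _ _ i j (F x))).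
move=> cA cB cC cD; apply: continuous_mx => i j.
case: (split_ordP i) => i' ->; case: (split_ordP j) => j' ->.
- by under eq_fun do rewrite block_mxEul; exact: coord.
- by under eq_fun do rewrite block_mxEur; exact: coord.
- by under eq_fun do rewrite block_mxEdl; exact: coord.
- by under eq_fun do rewrite block_mxEdr; exact: coord.
Qed.

Lemma continuous_ext m : continuous (@ext R m).
Proof.
by apply: continuous_block_mx => x; first [exact: cst_continuous|exact: cvg_id].
Qed.

Lemma continuous_plane_rot m (u : 'cV[R]_m) : continuous (fun t : R => plane_rot t u).
Proof.
have cst (k : R) : continuous (fun _ : R => k) by move=> t; exact: cst_continuous.
have csin := @continuous_sin R; have ccos := @continuous_cos R.
have cNsin : continuous (fun t : R => - sin t) by move=> t; apply: cvgN; exact: csin.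
have cNcos : continuous (fun t : R => - (1 - cos t)).
  by move=> t; apply: cvgN; exact: (continuous_add (cst 1) (fun s => cvgN (ccos s))).
apply: continuous_block_mx; apply: continuous_mx => i j.
- by under eq_fun do rewrite mxE -mulr_natr; exact: continuous_mul.
- by under eq_fun do rewrite mxE; exact: continuous_mul.
- by under eq_fun do rewrite mxE; exact: continuous_mul.
- rewrite (_ : (fun _ => _) =
      fun t => ((1%:M : 'M[R]_m) i j) + - (1 - cos t) * (u *m u^T) i j).
    by apply: continuous_add; [exact: cst|exact: continuous_mul].
  by apply/funext => t; rewrite !mxE mulNr.
Qed.

Lemma continuous_dot_mul m n (A : 'M[R]_(m, n)) (v : 'cV[R]_n) :
  continuous (fun X : 'M[R]_n => dot (A *m X *m v) (A *m X *m v)).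
Proof.
have c1 : continuous (fun X : 'M[R]_n => A *m X *m v).
  apply: (@mulmx_continuous R _ m n 1 (mulmx A) (fun=> v)).
    exact: continuous_mulmxl.
  by move=> x; exact: cst_continuous.
have c2 i : continuous (fun X : 'M[R]_n => (A *m X *m v) i 0).
  move=> x.
  exact: (continuous_comp (c1 x) (@coord_continuous _ _ _ i 0 (A *m x *m v))).
under eq_fun do rewrite dot_sum.
by apply: continuous_sum => i _; apply: continuous_mul.
Qed.

(** The map [X |-> X1 X X2^T] carries one set onto the other. A general [P] covers superlevel sets
    and level sets at once. *)
Lemma connected_SO_transport n (P : set R) (A X1 X2 : 'M[R]_n) :
  @SO R n X1 -> @SO R n X2 ->
  connected (@SO R n `&` [set X | P (mxinner (X1^T *m A *m X2) X)]) ->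
  connected (@SO R n `&` [set X | P (mxinner A X)]).
Proof.
move=> S1 S2 h.
have c : continuous (fun X => X1 *m X *m X2^T).
  apply: (@mulmx_continuous R _ n n n (mulmx X1) (fun=> X2^T)).
    exact: continuous_mulmxl.
  by move=> x; exact: cst_continuous.
have := connected_image h c; congr connected.
apply/seteqP; split => [_ [X [SX PX] <-]|X [SX PX]].
  split; first by apply: SO_mul; [exact: SO_mul|exact: SO_tr].
  by rewrite /= mxinner_mulr mxinner_mull trmxK mulmxA.
exists (X1^T *m X *m X2); first split.
- by apply: SO_mul => //; apply: SO_mul => //; exact: SO_tr.
- rewrite /= -(mulmxA _ X X2) mxinner_mull trmxK !mulmxA SO_mulVr // mul1mx.
  by rewrite mxinner_mulr -mulmxA SO_mulVr // mulmx1.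
- by rewrite !mulmxA SO_mulVr // mul1mx -mulmxA SO_mulVr // mulmx1.
Qed.

End Continuity.

(** * Superlevel sets *)

Section Superlevel.
Context {R : realType}.

(** Every vector is a multiple of a point of the orbit of [e0], so extremal stretches can be sought
    on the compact group instead of the sphere. *)
Lemma SO_polar m (x : 'cV[R]_(1 + m.+1)) :
  exists X r, [/\ 0 <= r, @SO R (1 + m.+1) X, x = r *: (X *m e0 _) & dot x x = r ^+ 2].
Proof.
have [->|/normalize[r [u [r0 u1 ->]]]] := eqVneq x 0.
  exists 1%:M, 0; split=> //; first exact: SO1.
    by rewrite scale0r.
  by rewrite dot0r expr0n.
have [X SX Xu] := SO_transitive u1; exists X, r.
by rewrite Xu; split => //; [exact: ltW|rewrite dotZl dotZr u1 mulr1 expr2].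
Qed.

Lemma exists_max_stretch m (A : 'M[R]_(1 + m.+1)) :
  exists2 X, @SO R (1 + m.+1) X & forall x,
    dot (A *m x) (A *m x) <= dot (A *m X *m e0 _) (A *m X *m e0 _) * dot x x.
Proof.
have ne : @SO R (1 + m.+1) !=set0 by exists 1%:M; exact: SO1.
have [X] := compact_EVT_max ne (@SO_compact R (1 + m.+1))
    (continuous_subspaceT (continuous_dot_mul (A := A) (v := e0 _))).
rewrite inE => SX max; exists X => // x.
have [Y [r [_ SY -> ->]]] := SO_polar x.
rewrite -scalemxAr dotZl dotZr mulrA -expr2 mulrC mulmxA ler_wpM2r ?sqr_ge0 //.
by apply: max; rewrite inE.
Qed.

Lemma exists_min_stretch m (A : 'M[R]_(1 + m.+1)) :
  exists2 X, @SO R (1 + m.+1) X & forall x,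
    dot (A *m X *m e0 _) (A *m X *m e0 _) * dot x x <= dot (A *m x) (A *m x).
Proof.
have ne : @SO R (1 + m.+1) !=set0 by exists 1%:M; exact: SO1.
have [X] := compact_EVT_min ne (@SO_compact R (1 + m.+1))
    (continuous_subspaceT (continuous_dot_mul (A := A) (v := e0 _))).
rewrite inE => SX max; exists X => // x.
have [Y [r [_ SY -> ->]]] := SO_polar x.
rewrite -scalemxAr dotZl dotZr mulrA -expr2 mulrC mulmxA ler_wpM2l ?sqr_ge0 //.
by apply: max; rewrite inE.
Qed.

(** This is one step of the singular value decomposition: [Y e0] is a top right singular vector,
    [X e0] the direction of its image, and [a] the largest singular value. *)
Lemma max_stretch_normal_form m (A : 'M[R]_(1 + m.+1)) :
  exists X Y a A0, [/\ @SO R (1 + m.+1) X, @SO R (1 + m.+1) Y, 0 <= a,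
    X^T *m A *m Y = block_mx a%:M 0 0 A0 &
    forall v, dot (A0 *m v) (A0 *m v) <= a ^+ 2 * dot v v].
Proof.
have [Y SY maxY] := exists_max_stretch A.
have [X [a [a0 SX AYa norma]]] := SO_polar (A *m Y *m e0 _).
pose B := X^T *m A *m Y.
have Be : B *m e0 _ = col_mx a%:M 0.
  rewrite /B -!mulmxA (mulmxA A) AYa -scalemxAr !mulmxA.
  by case: SX => -> _; rewrite mul1mx scale_col_mx scaler0 scale_scalar_mx mulr1.
have maxB x : dot (B *m x) (B *m x) <= a ^+ 2 * dot x x.
  have := maxY (Y *m x); rewrite norma (SO_dot _ _ SY) /B -!mulmxA.
  by rewrite (SO_dot _ _ (SO_tr SX)).
have [b [A0 EB]] : exists b A0, B = block_mx a%:M b 0 A0.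
  exists (usubmx (rsubmx B)), (dsubmx (rsubmx B)).
  by rewrite block_mxEh vsubmxK -{1}[B]hsubmxK lsubmxE Be.
have b0 : b = 0.
  (* With [d = |b|^2] and [e = |A0 b^T|^2], maximality at this vector reads
     [(a^2 + d)^2 + e <= a^2 (a^2 + d)], which forces [d = 0]. *)
  have := maxB (col_mx a%:M b^T).
  rewrite EB mul_block_col mul0mx add0r !dot_col_mx -scalar_mxM.
  have -> : b *m b^T = (dot b^T b^T)%:M by rewrite -dotE trmxK.
  rewrite -raddfD /= !dot11.
  have := dot_ge0 b^T; set d := dot b^T b^T.
  have := dot_ge0 (A0 *m b^T); set e := dot (A0 *m _) _ => e_ge0 d_ge0 h.
  have a2d : 0 <= a ^+ 2 * d by rewrite mulr_ge0 ?sqr_ge0.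
  have d0 : d = 0 by nra.
  by rewrite -[b]trmxK (dot_eq0 d0) trmx0.
exists X, Y, a, A0; split => //; first by rewrite -/B EB b0.
move=> v; have := maxB (col_mx 0 v).
by rewrite EB mul_block_col !mulmx0 !add0r b0 mul0mx !dot_col_mx dot0r !add0r.
Qed.

(** A block diagonal matrix does not see the sine entries. What remains is affine in [cos t], so the
    sign of one slope decides monotonicity along the rotation. *)
Lemma mxinner_plane_rot m (a : R) (A0 Q : 'M[R]_m) t u :
  mxinner (block_mx a%:M 0 0 A0) (plane_rot t u *m ext Q) =
  mxinner A0 Q - dot u (A0 *m Q^T *m u) + cos t * (a + dot u (A0 *m Q^T *m u)).
Proof.
have E : \tr (A0^T *m (u *m u^T) *m Q) = dot u (A0 *m Q^T *m u).
  have -> : A0^T *m (u *m u^T) *m Q = (A0^T *m u) *m (u^T *m Q) by rewrite !mulmxA.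
  by rewrite mxtrace_mulC -mxtrace_tr trace_mx11 /dot !trmx_mul !trmxK !mulmxA.
rewrite /plane_rot mulmx_block !mulmx0 !mulmx1 !add0r !addr0.
rewrite /mxinner tr_block_mx !trmx0 mulmx_block !mul0mx !add0r !addr0.
rewrite mxtrace_block tr_scalar_mx -scalar_mxM trace_mx11 mxE eqxx mulr1n.
rewrite mulmxBl mul1mx mulmxBr linearB /= -scalemxAl -scalemxAr mulmxA linearZ /=.
by rewrite E; ring.
Qed.

Lemma connected_superlevel n (A : 'M[R]_n) c :
  connected (@SO R n `&` [set X | c <= mxinner A X]).
Proof.
elim: n => [|n IH] in A c *.
  by apply: (@connected_sub1 _ _ (0 : 'M[R]_0)) => X _; exact: flatmx0.
case: n IH A => [_ A|n IH A].
  apply: (@connected_sub1 _ _ (1%:M : 'M[R]_1)) => X [[_ dX] _].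
  by move: dX; rewrite [X]mx11_scalar det_scalar1 => ->.
have [X1 [X2 [a [A0 [S1 S2 a0 EA maxA]]]]] := max_stretch_normal_form A.
apply: (connected_SO_transport (P := [set x | c <= x]) S1 S2).
rewrite /= EA; set B := block_mx _ _ _ _; set S := (X in connected X).
(* Undoing the rotation, that is, lowering its angle from [t] to 0, never leaves [S] and ends in the
   stabilizer of [e0]. *)
have dec X : S X -> exists t u Q, [/\ 0 <= t <= pi, S (ext Q),
    X = plane_rot t u *m ext Q & forall s, 0 <= s <= t -> S (plane_rot s u *m ext Q)].
  move=> [SX cX].
  have [t [u [Q [t0 u1 SQ EX]]]] := SO_decomp SX.
  have H s : 0 <= s <= t -> S (plane_rot s u *m ext Q).
    move=> /andP[s0 st]; split.
      by apply: SO_mul; [exact: SO_plane_rot|exact: SO_ext].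
    move: cX; rewrite /= EX !mxinner_plane_rot => /le_trans; apply; rewrite lerD2l.
    have cst : cos t <= cos s.
      case/andP: t0 => t_ge0 tpi; rewrite leNgt ltr_cos ?in_itv /= ?t_ge0 //.
        by rewrite -leNgt.
      by rewrite s0 (le_trans st).
    apply: ler_wpM2r => //.
    (* The slope [a + k] is nonnegative: [|A0 v| <= a] since [v] is a unit vector, so
       [|A0 v + a u|^2 >= 0] yields [0 <= 2 a (a + k)]. If [a = 0], then [A0 v = 0]. *)
    set v := Q^T *m u; rewrite -mulmxA -/v.
    have v1 : dot v v = 1 by rewrite SO_dot //; exact: SO_tr.
    have := dot_ge0 (A0 *m v + a *: u); have := maxA v.
    rewrite !(dotDl, dotDr, dotZl, dotZr) u1 v1 (dotC (A0 *m v) u).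
    set k := dot u _ => h1 h2; have [a_gt0|a_le0] := ltP 0 a.
      have {}h1 : 0 <= a * (a + k) by lra.
      by rewrite pmulr_rge0 in h1.
    have a_eq0 : a = 0 by apply/eqP; rewrite eq_le a_le0.
    rewrite a_eq0 expr0n mul0r in h1.
    have Av0 : A0 *m v = 0 by apply: dot_eq0; apply/eqP; rewrite eq_le h1 dot_ge0.
    by rewrite /k Av0 dot0r a_eq0 addr0.
  exists t, u, Q; split => //.
  have := H 0; rewrite plane_rot0 mul1mx; apply.
  by rewrite lexx; case/andP: t0.
have [[X0 SX0]|NS] := pselect (exists X, S X); last first.
  by apply: (@connected_sub1 _ _ (0 : 'M[R]_n.+2)) => X SX; case: NS; exists X.
have [t0 [u0 [Q0 [_ SQ0 _ _]]]] := dec _ SX0.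
(* [K] is the part of [S] fixing [e0], a superlevel set one size lower, hence connected by
   induction. It gathers the endpoints of all the paths. *)
pose K := @ext R n.+1 @` (@SO R n.+1 `&` [set Q | c - B 0 0 <= mxinner (drsubmx B) Q]).
have KE Q : S (ext Q) -> K (ext Q).
  move=> [SeQ cQ]; exists Q => //; split.
    have [Q' SQ' /eq_block_mx [_ _ _ ->]] := SO_fix_e0 SeQ (ext_e0 Q) => //.
  by move: cQ; rewrite /= mxinner_ext lerBlDl.
have KS : K `<=` S.
  move=> _ [Q [SQ cQ] <-]; split; first exact: SO_ext.
  by rewrite /= mxinner_ext -lerBlDl.
have cK : connected K by apply: connected_image; [exact: IH|exact: continuous_ext].
apply: (@connected_pairwise _ _ (ext Q0)) => X.
move=> /dec[t [u [Q [/andP[t_ge0 _] SQ EX path]]]].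
pose L := (fun s => plane_rot s u *m ext Q) @` `[0, t]%classic.
have LQ : L (ext Q).
  by exists 0; [rewrite /= in_itv /= lexx|rewrite plane_rot0 mul1mx].
exists (L `|` K); split.
- apply: connectedU => //; first by exists (ext Q); split => //; exact: KE.
  apply: connected_image; first exact: segment_connected.
  apply: (@mulmx_continuous R _ _ _ _ (fun s : R => plane_rot s u) (fun=> ext Q)).
    exact: continuous_plane_rot.
  by move=> x; exact: cst_continuous.
- by move=> Z [[s]|/KS//]; rewrite /= in_itv /= => st <-; exact: path.
- by right; exact: KE.
- by left; exists t => //=; rewrite in_itv /= lexx andbT.
Qed.

End Superlevel.

(** * The induction step for level sets *)

Section Level.
Context {R : realType}.

Lemma mxinner_scalar n (A : 'M[R]_n) s : mxinner A s%:M = s * \tr A.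
Proof. by rewrite /mxinner mul_mx_scalar mxtraceZ mxtrace_tr. Qed.

(** Diagonal sign matrices suffice: each sign is chosen to make its own term nonpositive, and the
    last two adjust the determinant. *)
Lemma exists_orthogonal_le0 k (B : 'M[R]_k.+2) (b : bool) :
  exists Q : 'M[R]_k.+2, [/\ Q^T *m Q = 1%:M, \det Q = (-1) ^+ b & mxinner B Q <= 0].
Proof.
have blockP m (s : bool) (Q : 'M[R]_m) (b' : bool) :
    Q^T *m Q = 1%:M -> \det Q = (-1) ^+ b' ->
    let P := block_mx ((-1) ^+ s)%:M 0 0 Q : 'M[R]_(1 + m) in
    P^T *m P = 1%:M /\ \det P = (-1) ^+ (s (+) b').
  move=> QQ dQ; split; last by rewrite det_ublock det_scalar1 dQ signr_addb.
  rewrite tr_block_mx mulmx_block !trmx0 tr_scalar_mx -scalar_mxM !mulmx0 !mul0mx.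
  by rewrite -signr_addb addbb !addr0 add0r QQ (@scalar_mx_block _ 1 m).
have sgn (x : R) : exists s : bool, (-1) ^+ s * x <= 0.
  have [x0|x0] := leP x 0; first by exists false; rewrite mul1r.
  by exists true; rewrite mulN1r oppr_le0 ltW.
elim: k => [|k IH] in B b *.
  (* In size 2 the determinant fixes the product of the two signs; flipping both is still free and
     negates the inner product. *)
  have [s hs] :=
    sgn (\tr (@ulsubmx _ 1 1 1 1 B) + (-1) ^+ b * \tr (@drsubmx _ 1 1 1 1 B)).
  have [||PP dP] := @blockP 1%N s ((-1) ^+ (s (+) b))%:M (s (+) b).
  - by rewrite tr_scalar_mx -scalar_mxM -signr_addb addbb.
  - by rewrite det_scalar1.
  exists (block_mx ((-1) ^+ s)%:M 0 0 ((-1) ^+ (s (+) b))%:M : 'M[R]_(1 + 1)).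
  split => //; first by rewrite dP addbA addbb.
  by rewrite (@mxinner_block _ 1 1) !mxinner_scalar signr_addb -mulrA -mulrDr.
have [s hs] := sgn (\tr (@ulsubmx _ 1 k.+2 1 k.+2 B)).
have [Q [QQ dQ BQ]] := IH (@drsubmx _ 1 k.+2 1 k.+2 B) (s (+) b).
have [PP dP] := blockP _ s _ _ QQ dQ.
exists (block_mx ((-1) ^+ s)%:M 0 0 Q : 'M[R]_(1 + k.+2)).
split => //; first by rewrite dP addbA addbb.
by rewrite (@mxinner_block _ 1 k.+2) !mxinner_scalar; lra.
Qed.

Lemma mx00E m (A : 'M[R]_(1 + m)) : A 0 0 = dot (e0 m) (A *m e0 m).
Proof.
rewrite -lsubmxE -[lsubmx A]vsubmxK dot_col_mx (dotC 0) dot0r addr0.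
rewrite [usubmx _]mx11_scalar dot11 mul1r !mxE.
by congr (A _ _); apply/val_inj.
Qed.

(** Take [Q] sending [p] to [q], which contributes [dot q (B *m p)], and let it map the complement
    of [p] to that of [q] with a nonpositive contribution. *)
Lemma exists_SO_le k (B : 'M[R]_k.+3) p q : dot p p = 1 -> dot q q = 1 ->
  exists2 Q, @SO R k.+3 Q & mxinner B Q <= dot q (B *m p).
Proof.
move=> p1 q1; have [X SX Xp] := @SO_transitive R k.+1 p p1.
have [Y SY Yq] := @SO_transitive R k.+1 q q1.
have [Q [QQ dQ BQ]] :=
  exists_orthogonal_le0 (@drsubmx _ 1 k.+2 1 k.+2 (Y^T *m (B *m X))) false.
exists (Y *m @ext R k.+2 Q *m X^T).
  by apply: SO_mul; [apply: SO_mul => //; exact: SO_ext|exact: SO_tr].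
rewrite mxinner_mulr mxinner_mull trmxK (@mxinner_ext R k.+2) (@mx00E k.+2).
rewrite -mulmxA dot_mulr trmxK Yq -mulmxA Xp; lra.
Qed.

(** A matrix and its transpose have the same smallest singular value. If [B] is singular, then
    [M = 0]; otherwise write [z = B w] and apply Cauchy-Schwarz to [dot z z = dot (B^T *m z) w]. *)
Lemma min_stretch_tr n (B : 'M[R]_n) M : 0 <= M ->
  (forall x, M * dot x x <= dot (B *m x) (B *m x)) ->
  forall z, M * dot z z <= dot (B^T *m z) (B^T *m z).
Proof.
move=> M0 minB z; have [B0|Bu] := eqVneq (\det B^T) 0.
  have /eqP/det0P[v v0 vB] := B0.
  have Bv : B *m v^T = 0 by rewrite -[B]trmxK -trmx_mul vB trmx0.
  have vv : 0 < dot v^T v^T.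
    rewrite lt_neqAle dot_ge0 andbT eq_sym; apply: contra v0 => /eqP/dot_eq0.
    by move/(congr1 trmx); rewrite trmxK trmx0 => ->.
  have := minB v^T; rewrite Bv dot0r pmulr_lle0 // => M_le0.
  by rewrite (_ : M = 0) ?mul0r ?dot_ge0 //; apply/eqP; rewrite eq_le M_le0.
have uB : B \in unitmx by rewrite unitmxE unitfE -det_tr.
pose w := invmx B *m z; have zE : z = B *m w by rewrite mulKVmx.
have := minB w; rewrite -zE => h1.
have := cauchy_schwarz (B^T *m z) w; rewrite -dot_mulr -zE => h2.
have [z0|z0] := eqVneq (dot z z) 0; first by rewrite z0 mulr0 dot_ge0.
have z_gt0 : 0 < dot z z by rewrite lt_neqAle eq_sym z0 dot_ge0.
have h3 := ler_wpM2l M0 h2.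
have h4 := ler_wpM2l (dot_ge0 (B^T *m z)) h1.
have h5 : dot z z * (M * dot z z) <= dot z z * dot (B^T *m z) (B^T *m z) by lra.
by rewrite ler_pM2l in h5.
Qed.

(* Take v orthogonal to the lower part of N e0. Then N^T (0, v) is orthogonal to
   e0 and at least as long as N e0, so choosing Q to send its opposite direction
   to v compensates the entry N 0 0. *)
Lemma exists_SO_ext_le0 k (N : 'M[R]_(1 + k.+3)) :
  (forall z, dot (N *m e0 _) (N *m e0 _) * dot z z <= dot (N^T *m z) (N^T *m z)) ->
  exists2 Q, @SO R k.+3 Q & mxinner N (ext Q) <= 0.
Proof.
move=> minN.
have [v v1 nv] := orthogonal_unit_vector (dlsubmx N).
pose w := (drsubmx N)^T *m v.
have wN : N 0 0 ^+ 2 <= dot w w.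
  have := minN (col_mx 0 v).
  rewrite -lsubmxE -{3 4}[N]submxK tr_block_mx mul_block_col !mulmx0 !add0r.
  rewrite dotE nv !dot_col_mx dot0r !add0r v1 mulr1 !dot11 mulr0 add0r.
  rewrite -[lsubmx N]vsubmxK dot_col_mx [usubmx _]mx11_scalar dot11.
  have -> : usubmx (lsubmx N) 0 0 = N 0 0.
    by rewrite !mxE; congr (N _ _); apply/val_inj.
  by have := dot_ge0 (dsubmx (lsubmx N)); rewrite -/w; lra.
have [p p1 Np] : exists2 p, dot p p = 1 & N 0 0 + dot v (drsubmx N *m p) <= 0.
  have [w0|/normalize[r [p [r0 p1 wE]]]] := eqVneq w 0.
    have [p p1] := @unit_vector R k.+2; exists p => //.
    rewrite dot_mulr -/w w0 (dotC 0) dot0r addr0.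
    by move: wN; rewrite w0 dot0r; nra.
  exists (- 1 *: p); first by rewrite dotZl dotZr p1; ring.
  rewrite dot_mulr -/w dotZr wE dotZl p1.
  by move: wN; rewrite wE dotZl dotZr p1; nra.
have [Q SQ NQ] := exists_SO_le (drsubmx N) p1 v1.
by exists Q => //; rewrite mxinner_ext; lra.
Qed.

Lemma level_compact n (A : 'M[R]_n) c :
  compact (@SO R n `&` [set X | mxinner A X = c]).
Proof.
apply: compact_closedI; first exact: SO_compact.
have /continuous_closedP/(_ [set c]) := @mxinner_continuous R n A; apply.
exact: closed_eq.
Qed.

Lemma connected_IVT (T : topologicalType) (S : set T) (f : T -> R) x y c :
  connected S -> continuous f -> S x -> S y -> f x <= c <= f y ->
  exists2 z, S z & f z = c.
Proof.
move=> cS cf Sx Sy fxy.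
have /connected_intervalP h := connected_image cS cf.
have fS z : S z -> (f @` S) (f z) by exists z.
by have [z Sz fz] := h _ _ (fS x Sx) (fS y Sy) c fxy; exists z.
Qed.

Lemma connected_level_step k (A : 'M[R]_(1 + k.+3)) c :
  (forall (B : 'M[R]_k.+3) d, connected (@SO R k.+3 `&` [set X | mxinner B X = d])) ->
  connected (@SO R (1 + k.+3) `&` [set X | mxinner A X = c]).
Proof.
move=> IH; wlog c0 : A c / 0 <= c.
  move=> H; have [c_ge0|/ltW c_le0] := leP 0 c; first exact: H.
  have := H (- A) (- c); rewrite oppr_ge0 => /(_ c_le0); congr (connected (_ `&` _)).
  apply/funext => X; apply/propext.
  rewrite /= /mxinner raddfN /= mulNmx raddfN /=; split => [/oppr_inj//|->//].
have [X0 SX0 minA] := exists_min_stretch A.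
apply: (connected_SO_transport (P := [set c]) (@SO1 R _) SX0).
have {minA} : forall x, dot (A *m X0 *m e0 _) (A *m X0 *m e0 _) * dot x x <=
    dot (A *m X0 *m x) (A *m X0 *m x).
  by move=> x; rewrite -(SO_dot x x SX0) -(mulmxA A X0 x).
rewrite trmx1 mul1mx; move: (A *m X0) => {SX0 X0}B /(min_stretch_tr (dot_ge0 _)) minB.
set S := (X in connected X).
(* Every fiber [Y SO(k.+3)] contains a point where the inner product is nonpositive, since [Y^T B]
   inherits the bound [minB]. *)
have low Y : @SO R (1 + k.+3) Y ->
    exists2 Q, @SO R k.+3 Q & mxinner B (Y *m ext Q) <= 0.
  move=> SY; have [|Q SQ NQ] := @exists_SO_ext_le0 k (Y^T *m B).
    move=> z; rewrite -!mulmxA (SO_dot _ _ (SO_tr SY)) trmx_mul trmxK -mulmxA.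
    by rewrite -(SO_dot z z SY).
  by exists Q => //; rewrite mxinner_mull.
have cSO : connected (@SO R k.+3).
  (* The whole group is the level set of the zero matrix at level 0. *)
  have := IH 0 0; congr connected; apply/seteqP; split => [X []//|X SX]; split => //.
  by rewrite /= /mxinner trmx0 mul0mx mxtrace0.
have cYext (Y : 'M[R]_(1 + k.+3)) : continuous (fun Q : 'M[R]_k.+3 => Y *m ext Q).
  move=> Q; exact: (continuous_comp (@continuous_ext R _ Q)
    (@continuous_mulmxl R _ _ _ Y (ext Q))).
have inner_ext Y Q : mxinner B (Y *m ext Q) =
    (Y^T *m B) 0 0 + mxinner (drsubmx (Y^T *m B)) Q.
  by rewrite mxinner_mull mxinner_ext.
apply: (@connected_fibers _ _ (fun X : 'M[R]_(1 + k.+3) => X *m e0 _)).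
- exact: mx_hausdorff.
- exact: continuous_mulmxr.
- exact: level_compact.
- have := connected_image (@connected_superlevel R _ B c)
    (@continuous_mulmxr R _ _ _ (e0 _)).
  congr connected; apply/seteqP; split => [y|_ [X [SX <-] <-]].
    move=> [Y [SY cY] <-].
    (* On the connected fiber through [Y] the value is at most [0 <= c] at [Q0] and at least [c] at
       the identity, so [c] is attained. *)
    have [Q0 SQ0 BQ0] := low Y SY.
    have [||Q SQ BQ] := @connected_IVT _ _
      (fun Q => mxinner B (Y *m ext Q)) Q0 1%:M c cSO _ SQ0 (@SO1 R _).
    + move=> Q.
      apply: (@continuous_comp _ _ _ (fun P => Y *m ext P) (mxinner B) Q (cYext Y Q)).
      exact: mxinner_continuous.
    + rewrite (le_trans BQ0 c0) /=.
      by rewrite /ext -(@scalar_mx_block _ 1 k.+3) mulmx1.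
    exists (Y *m ext Q); last by rewrite -mulmxA ext_e0.
    by split => //; apply: SO_mul => //; exact: SO_ext.
  by exists X => //; split => //=; rewrite lexx.
- move=> y.
  have [[Y [SY BY] Yy]|NY] := pselect (exists2 Y, S Y & Y *m e0 _ = y); last first.
    apply: (@connected_sub1 _ _ (0 : 'M[R]_(1 + k.+3))) => X [SX Xy].
    by case: NY; exists X.
  (* The fiber through [Y] is the translate by [Y] of a level set in SO(k.+3). *)
  have := connected_image (IH (drsubmx (Y^T *m B)) (c - (Y^T *m B) 0 0)) (cYext Y).
  congr connected; apply/seteqP; split => [_ [Q [SQ BQ] <-]|X [[SX BX] Xy]].
    split; last by rewrite /= -mulmxA ext_e0.
    split; first by apply: SO_mul => //; exact: SO_ext.
    by rewrite /= inner_ext BQ addrC subrK.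
  have [||Q SQ EQ] := @SO_fix_e0 R _ (Y^T *m X).
  + by apply: SO_mul => //; exact: SO_tr.
  + by rewrite -mulmxA [X *m _]Xy -Yy mulmxA; case: SY => -> _; rewrite mul1mx.
  have XE : X = Y *m ext Q by rewrite -EQ mulmxA SO_mulVr // mul1mx.
  exists Q => //; split => //=.
  by move: BX; rewrite XE /= inner_ext => <-; rewrite addrAC subrr add0r.
Qed.

End Level.

(** * Level sets in SO(3) *)

Section Quadric.
Context {R : realType}.

Lemma continuous_scale_add (f g : R -> R) n (p q : 'cV[R]_n) :
  continuous f -> continuous g -> continuous (fun t => f t *: p + g t *: q).
Proof.
move=> cf cg; apply: continuous_mx => i j.
rewrite (_ : (fun _ => _) = fun t => f t * p i j + g t * q i j); last first.
  by apply/funext => t; rewrite !mxE.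
by apply: continuous_add; apply: continuous_mul => // t; exact: cst_continuous.
Qed.

Variables (n : nat) (T : topologicalType) (F : 'cV[R]_n.+3 -> T) (M : 'M[R]_n.+3).
Hypothesis M_sym : M^T = M.
Hypothesis F_cont : forall q, q != 0 -> {for q, continuous F}.
Hypothesis F_scale : forall k q, k != 0 -> F (k *: q) = F q.

Let b (p q : 'cV[R]_n.+3) := dot p (M *m q).
(** Since [F] is invariant under scaling, [C] is the image of a projective quadric, and no
    projective space has to be formed. *)
Let C := F @` [set q | q != 0 /\ b q q = 0].

Let bC p q : b p q = b q p.
Proof. by rewrite /b dotC dot_mulr M_sym dotC dot_mulr M_sym dotC. Qed.

Let bD p q r : b p (q + r) = b p q + b p r.
Proof. by rewrite /b mulmxDr dotDr. Qed.

Let bZ p q k : b p (k *: q) = k * b p q.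
Proof. by rewrite /b -scalemxAr dotZr. Qed.

Let bDl p q r : b (q + r) p = b q p + b r p.
Proof. by rewrite bC bD !(bC p). Qed.

Let bZl p q k : b (k *: q) p = k * b q p.
Proof. by rewrite bC bZ bC. Qed.

Let joined p q := exists D, [/\ connected D, D `<=` C, D (F p) & D (F q)].

Lemma joined_path (g : R -> 'cV[R]_n.+3) : continuous g ->
  (forall t, g t != 0) -> (forall t, b (g t) (g t) = 0) -> joined (g 0) (g 1).
Proof.
move=> cg g0 gb; exists ((F \o g) @` `[0, 1]%classic); split.
- apply: connected_image; first exact: segment_connected.
  by move=> t; apply: continuous_comp; [exact: cg|exact: F_cont].
- by move=> _ [t _ <-]; exists (g t).
- by exists 0 => //=; rewrite in_itv /= lexx ler01.
- by exists 1 => //=; rewrite in_itv /= lexx ler01.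
Qed.

Lemma joined_trans p q r : joined p q -> joined q r -> joined p r.
Proof.
move=> [D [cD DC Dp Dq]] [E [cE EC Eq Er]]; exists (D `|` E); split.
- by apply: connectedU => //; exists (F q).
- by rewrite subUset.
- by left.
- by right.
Qed.

(** The segment from [p] to [q] is isotropic. It could meet 0 only for proportional vectors, and
    those have the same image under [F]. *)
Lemma joined_orthogonal p q : p != 0 -> q != 0 ->
  b p p = 0 -> b q q = 0 -> b p q = 0 -> joined p q.
Proof.
move=> p0 q0 bp bq bpq; have [[k qk]|nk] := pselect (exists k, q = k *: p).
  have k0 : k != 0 by apply: contra q0 => /eqP k0; rewrite qk k0 scale0r.
  rewrite /joined qk F_scale //; exists [set F p]; split => //; first exact: connected1.
  by move=> _ ->; exists p.
pose g t := (1 - t) *: p + t *: q.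
have -> : p = g 0 by rewrite /g subr0 scale1r scale0r addr0.
have -> : q = g 1 by rewrite /g subrr scale0r scale1r add0r.
apply: joined_path => [|t|t].
- apply: continuous_scale_add => t; last exact: cvg_id.
  by apply: cvgB; [exact: cst_continuous|exact: cvg_id].
- apply/eqP => gt; have [t0|t0] := eqVneq t 0.
    by move: gt p0; rewrite /g t0 subr0 scale1r scale0r addr0 => ->; rewrite eqxx.
  apply: nk; exists (- (t^-1 * (1 - t))).
  apply: (scalerI t0); rewrite scalerA mulrN mulrA divff // mul1r scaleNr.
  by apply/eqP; rewrite -addr_eq0 addrC; apply/eqP.
- by rewrite /g !(bD, bZ, bDl, bZl) bp bq bpq (bC q) bpq; ring.
Qed.

(* Rescaling the first vector by a sign makes the discriminant of the conic
   cut out on span(p, q, w) positive. *)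
Lemma joined_conic p q w : b p p = 0 -> b q q = 0 -> b p q != 0 ->
  b w p = 0 -> b w q = 0 -> b w w != 0 -> joined p q.
Proof.
move=> bp bq bpq bwp bwq bw.
wlog neg : p bp bpq bwp / b p q * b w w < 0.
  move=> H; have /orP[h|h] : (b p q * b w w < 0) || (0 < b p q * b w w).
  - by rewrite -neq_lt mulf_neq0.
  - exact: H.
  - have := H (- 1 *: p); rewrite !(bZ, bZl) bp bwp !mulr0 mulN1r oppr_eq0 mulNr.
    rewrite oppr_lt0 => /(_ erefl bpq erefl h).
    by rewrite /joined F_scale // oppr_eq0 oner_eq0.
(* Along the curve [g] below, the form equals [t^2 (1 - t)^2 (2 b p q + s^2 b w w)]; this [s] makes
   it vanish. *)
pose s := Num.sqrt (- 2 * b p q / b w w).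
have s2 : s ^+ 2 * b w w = - 2 * b p q.
  rewrite sqr_sqrtr; first by rewrite divfK.
  rewrite -(pmulr_lge0 _ (_ : 0 < b w w ^+ 2)); last by rewrite exprn_even_gt0.
  by rewrite expr2 mulrA divfK //; nra.
pose g t := (1 - t) ^+ 2 *: p + (t ^+ 2 *: q + (t * (1 - t) * s) *: w).
have -> : p = g 0.
  by rewrite /g subr0 expr1n scale1r !mul0r expr0n !scale0r !addr0.
have -> : q = g 1.
  by rewrite /g subrr expr1n expr0n mulr0 mul0r !scale0r !scale1r !addr0 add0r.
have bqp : b q p != 0 by rewrite bC.
apply: joined_path => [|t|t].
- apply: continuous_mx => i j.
  rewrite (_ : (fun _ => _) = fun t => (1 - t) * (1 - t) * p i j +
      (t * t * q i j + t * (1 - t) * (s * w i j))); last first.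
    by apply/funext => u; rewrite !mxE; ring.
  have c1 (k : R) : continuous (fun _ : R => k) by move=> u; exact: cst_continuous.
  have ci : continuous (fun u : R => u) by move=> u; exact: cvg_id.
  have c2 : continuous (fun u : R => 1 - u).
    by move=> u; apply: cvgB; [exact: c1|exact: ci].
  by repeat first [exact: c1|exact: c2|exact: ci
    |apply: continuous_add|apply: continuous_mul].
- apply/eqP => gt.
  (* If [g t = 0], pairing with [q] gives [t = 1], and then pairing with [p] contradicts
     [b p q != 0]. *)
  have : b p (g t) = 0 by rewrite gt /b mulmx0 dot0r.
  have : b q (g t) = 0 by rewrite gt /b mulmx0 dot0r.
  rewrite /g !(bD, bZ) bp bq (bC p w) (bC q w) bwp bwq !mulr0 !addr0 => /eqP.
  rewrite mulf_eq0 (negbTE bqp) orbF sqrf_eq0 subr_eq0 => /eqP <-.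
  by rewrite add0r expr1n mul1r => /eqP; rewrite (negbTE bpq).
- rewrite /g !(bD, bZ, bDl, bZl) bp bq (bC q p) (bC p w) (bC q w) bwp bwq.
  by rewrite !mulr0; nra.
Qed.

Lemma connected_quadric : connected C.
Proof.
have [[p [p0 bp]]|NC] := pselect (exists p, p != 0 /\ b p p = 0); last first.
  by apply: (@connected_sub1 _ _ (F 0)) => x [q [q0 bq] _]; case: NC; exists q.
apply: (@connected_pairwise _ _ (F p)) => _ [q [q0 bq] <-].
change (joined p q).
have [bpq|bpq] := eqVneq (b p q) 0; first exact: joined_orthogonal.
(* Two linear conditions in dimension at least 3 leave a nonzero [w] orthogonal to [p] and [q]. If
   [w] is isotropic it serves as a stopover, otherwise it spans a conic with them. *)
have /rowV0Pn[w' /sub_kermxP] : kermx (row_mx (M *m p) (M *m q)) != 0.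
  rewrite kermx_eq0; apply/negP => /eqP rv.
  by have := rank_leq_col (row_mx (M *m p) (M *m q)); rewrite rv.
rewrite mul_mx_row => /eqP; rewrite row_mx_eq0 => /andP[/eqP wp /eqP wq] w'0.
pose w := w'^T.
have w0 : w != 0 by rewrite -trmx0 (inj_eq trmx_inj).
have bwp : b w p = 0 by rewrite /b /dot trmxK wp mxE.
have bwq : b w q = 0 by rewrite /b /dot trmxK wq mxE.
have [bw|bw] := eqVneq (b w w) 0; last exact: (joined_conic bp bq bpq bwp bwq).
by apply: (@joined_trans _ w); apply: joined_orthogonal => //; rewrite bC.
Qed.

End Quadric.

(** * Quaternions and rotations of three-space *)

Section Quaternion.
Context {R : realType}.

(** Entries given by explicit lists reduce by computation, which leaves polynomial identities for
    [ring] and [lra]. *)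
Definition mx_of_rows m n (s : seq (seq R)) : 'M[R]_(m, n) :=
  \matrix_(i, j) nth 0 (nth [::] s i) j.

Lemma mx3_rows (X : 'M[R]_3) : exists x00 x01 x02 x10 x11 x12 x20 x21 x22,
  X = mx_of_rows 3 3 [:: [:: x00; x01; x02]; [:: x10; x11; x12]; [:: x20; x21; x22]].
Proof.
pose x (i j : nat) := X (inord i) (inord j).
exists (x 0 0)%N, (x 0 1)%N, (x 0 2)%N, (x 1 0)%N, (x 1 1)%N, (x 1 2)%N.
exists (x 2 0)%N, (x 2 1)%N, (x 2 2)%N.
apply/matrixP => i j; rewrite mxE -[LHS]/(X i j).
rewrite -[i in LHS]inord_val -[j in LHS]inord_val.
by case: i => [[|[|[|]]]] //= ?; case: j => [[|[|[|]]]].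
Qed.

Lemma det_rows3 x00 x01 x02 x10 x11 x12 x20 x21 x22 :
  \det (mx_of_rows 3 3
    [:: [:: x00; x01; x02]; [:: x10; x11; x12]; [:: x20; x21; x22]]) =
  x00 * (x11 * x22 - x12 * x21) - x01 * (x10 * x22 - x12 * x20)
   + x02 * (x10 * x21 - x11 * x20).
Proof.
rewrite (expand_det_row _ ord0) !big_ord_recl big_ord0 /cofactor.
rewrite !(expand_det_row _ ord0) !big_ord_recl !big_ord0 /cofactor !det_mx11 !mxE /=.
rewrite /bump /= !addn0 !expr0 !expr1.
ring.
Qed.

Lemma cV4_rows (q : 'cV[R]_4) : exists a b c d,
  q = mx_of_rows 4 1 [:: [:: a]; [:: b]; [:: c]; [:: d]].
Proof.
pose x (i : nat) := q (inord i) 0.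
exists (x 0)%N, (x 1)%N, (x 2)%N, (x 3)%N.
apply/matrixP => i j; rewrite mxE (ord1 j) -[LHS]/(q i 0) -[i in LHS]inord_val.
by case: i => [[|[|[|[|]]]]] //= ?.
Qed.

Local Notation o n k := (@Ordinal n k isT).

(** The Euler-Rodrigues matrix of [x |-> q x q*] on imaginary quaternions, for
    [q = a + b i + c j + d k]. *)
Definition quat_rot (q : 'cV[R]_4) : 'M[R]_3 :=
  let a := q (o 4 0) 0 in let b := q (o 4 1) 0 in
  let c := q (o 4 2) 0 in let d := q (o 4 3) 0 in
  mx_of_rows 3 3
    [:: [:: a * a + b * b - c * c - d * d; 2 * (b * c - a * d); 2 * (b * d + a * c)];
        [:: 2 * (b * c + a * d); a * a - b * b + c * c - d * d; 2 * (c * d - a * b)];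
        [:: 2 * (b * d - a * c); 2 * (c * d + a * b); a * a - b * b - c * c + d * d]].

(** The symmetric matrix of the quadratic form [q |-> <X, quat_rot q>]; see [mxinner_quat_rot]. *)
Definition quat_form (X : 'M[R]_3) : 'M[R]_4 :=
  let x00 := X (o 3 0) (o 3 0) in let x01 := X (o 3 0) (o 3 1) in
  let x02 := X (o 3 0) (o 3 2) in let x10 := X (o 3 1) (o 3 0) in
  let x11 := X (o 3 1) (o 3 1) in let x12 := X (o 3 1) (o 3 2) in
  let x20 := X (o 3 2) (o 3 0) in let x21 := X (o 3 2) (o 3 1) in
  let x22 := X (o 3 2) (o 3 2) in
  mx_of_rows 4 4
    [:: [:: x00 + x11 + x22; x21 - x12; x02 - x20; x10 - x01];
        [:: x21 - x12; x00 - x11 - x22; x01 + x10; x02 + x20];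
        [:: x02 - x20; x01 + x10; x11 - x00 - x22; x12 + x21];
        [:: x10 - x01; x02 + x20; x12 + x21; x22 - x00 - x11]].

Lemma quat_form_sym X : (quat_form X)^T = quat_form X.
Proof.
apply/matrixP => i j; rewrite !mxE.
by case: i => [[|[|[|[|]]]]] //= ?; case: j => [[|[|[|[|]]]]].
Qed.

Lemma mxinner_rows3 x00 x01 x02 x10 x11 x12 x20 x21 x22
    y00 y01 y02 y10 y11 y12 y20 y21 y22 :
  mxinner
    (mx_of_rows 3 3
    [:: [:: x00; x01; x02]; [:: x10; x11; x12]; [:: x20; x21; x22]])
    (mx_of_rows 3 3 [:: [:: y00; y01; y02]; [:: y10; y11; y12]; [:: y20; y21; y22]]) =
  x00 * y00 + x01 * y01 + x02 * y02 + x10 * y10 + x11 * y11 + x12 * y12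
  + x20 * y20 + x21 * y21 + x22 * y22.
Proof.
rewrite /mxinner /mxtrace !big_ord_recl big_ord0 !mxE.
by rewrite !big_ord_recl !big_ord0 !mxE /=; ring.
Qed.

Lemma dot_rows4 (a b c d x y z t : R) :
  dot (mx_of_rows 4 1 [:: [:: a]; [:: b]; [:: c]; [:: d]])
      (mx_of_rows 4 1 [:: [:: x]; [:: y]; [:: z]; [:: t]]) =
  a * x + b * y + c * z + d * t.
Proof. by rewrite dot_sum !big_ord_recl big_ord0 !mxE /=; ring. Qed.

Lemma mul_rows4 a b c d x00 x01 x02 x03 x10 x11 x12 x13 x20 x21 x22 x23
    x30 x31 x32 x33 :
  mx_of_rows 4 4 [:: [:: x00; x01; x02; x03]; [:: x10; x11; x12; x13];
                     [:: x20; x21; x22; x23]; [:: x30; x31; x32; x33]]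
    *m mx_of_rows 4 1 [:: [:: a]; [:: b]; [:: c]; [:: d]] =
  mx_of_rows 4 1 [:: [:: x00 * a + x01 * b + x02 * c + x03 * d];
                     [:: x10 * a + x11 * b + x12 * c + x13 * d];
                     [:: x20 * a + x21 * b + x22 * c + x23 * d];
                     [:: x30 * a + x31 * b + x32 * c + x33 * d]].
Proof.
apply/matrixP => i j; rewrite (ord1 j) !mxE !big_ord_recl big_ord0 !mxE /=.
by case: i => [[|[|[|[|]]]]] //= ?; ring.
Qed.

Lemma mxinner_quat_rot A q : mxinner A (quat_rot q) = dot q (quat_form A *m q).
Proof.
have [x00 [x01 [x02 [x10 [x11 [x12 [x20 [x21 [x22 ->]]]]]]]]] := mx3_rows A.
have [a [b [c [d ->]]]] := cV4_rows q.
rewrite /quat_rot /quat_form mxinner_rows3 mul_rows4 dot_rows4 !mxE /=.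
ring.
Qed.

Lemma quat_rot_orthogonal q : (quat_rot q)^T *m quat_rot q = (dot q q ^+ 2)%:M.
Proof.
have [a [b [c [d ->]]]] := cV4_rows q; rewrite dot_rows4.
apply/matrixP => i j; rewrite !mxE !big_ord_recl big_ord0 !mxE /=.
by case: i => [[|[|[|]]]] //= ?; case: j => [[|[|[|]]]] //= ?; ring.
Qed.

Lemma det_quat_rot q : \det (quat_rot q) = dot q q ^+ 3.
Proof.
have [a [b [c [d ->]]]] := cV4_rows q.
by rewrite det_rows3 dot_rows4 !mxE /=; ring.
Qed.

Lemma quat_rotZ k q : quat_rot (k *: q) = k ^+ 2 *: quat_rot q.
Proof.
apply/matrixP => i j; rewrite !mxE.
by case: i => [[|[|[|]]]] //= ?; case: j => [[|[|[|]]]] //= ?; ring.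
Qed.

Lemma continuous_dot n m (f g : 'cV[R]_n -> 'cV[R]_m) :
  continuous f -> continuous g -> continuous (fun q => dot (f q) (g q)).
Proof.
move=> cf cg; under eq_fun do rewrite dot_sum.
by apply: continuous_sum => i _; apply: continuous_mul => q;
  [exact: (continuous_comp (cf q) (@coord_continuous _ _ _ i 0 (f q)))
  |exact: (continuous_comp (cg q) (@coord_continuous _ _ _ i 0 (g q)))].
Qed.

Lemma mxinner_delta n i j (X : 'M[R]_n) : mxinner (delta_mx i j) X = X i j.
Proof.
rewrite /mxinner trmx_delta /mxtrace (bigD1 j) //= big1 => [|k kj].
  rewrite addr0 mxE (bigD1 i) //= big1 ?addr0 => [|l li]; rewrite mxE eqxx.
    by rewrite eqxx mul1r.
  by rewrite (negbTE li) mul0r.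
by rewrite mxE big1 // => l _; rewrite mxE (negbTE kj) mul0r.
Qed.

(** Each entry is the inner product with a [delta_mx], hence a quadratic form in [q]. *)
Lemma continuous_quat_rot : continuous quat_rot.
Proof.
apply: continuous_mx => i j.
under eq_fun do rewrite -mxinner_delta mxinner_quat_rot.
by apply: continuous_dot => [q|]; [exact: cvg_id|exact: continuous_mulmxl].
Qed.

(** Dividing by the squared norm gives a scale-invariant map on nonzero quaternions, as
    [connected_quadric] expects. *)
Definition unit_quat_rot q : 'M[R]_3 := (dot q q)^-1 *: quat_rot q.

Lemma SO_unit_quat_rot q : q != 0 -> @SO R 3 (unit_quat_rot q).
Proof.
move=> q0; have qq : dot q q != 0 by apply: contra q0 => /eqP/dot_eq0 ->.
split; last by rewrite detZ det_quat_rot -exprMn mulVf ?expr1n.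
rewrite /unit_quat_rot -scalemxAr linearZ /= -scalemxAl quat_rot_orthogonal scalerA.
rewrite scale_scalar_mx.
by rewrite -expr2 -exprMn mulVf ?expr1n.
Qed.

Lemma unit_quat_rotZ k q : k != 0 -> unit_quat_rot (k *: q) = unit_quat_rot q.
Proof.
move=> k0; rewrite /unit_quat_rot quat_rotZ dotZl dotZr scalerA; congr (_ *: _).
by rewrite mulrA -expr2 invfM mulrAC mulVf ?mul1r // sqrf_eq0.
Qed.

Lemma continuous_unit_quat_rot q : q != 0 -> {for q, continuous unit_quat_rot}.
Proof.
move=> q0; have qq : dot q q != 0 by apply: contra q0 => /eqP/dot_eq0 ->.
have cdot : continuous (fun q : 'cV[R]_4 => dot q q).
  by apply: continuous_dot => p; exact: cvg_id.
exact: (cvgZ (cvgV qq (cdot q)) (@continuous_quat_rot q)).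
Qed.

Lemma adj_rows3 x00 x01 x02 x10 x11 x12 x20 x21 x22 :
  \adj (mx_of_rows 3 3
    [:: [:: x00; x01; x02]; [:: x10; x11; x12]; [:: x20; x21; x22]]) =
  mx_of_rows 3 3
    [:: [:: x11 * x22 - x12 * x21; x02 * x21 - x01 * x22; x01 * x12 - x02 * x11];
     [:: x12 * x20 - x10 * x22; x00 * x22 - x02 * x20; x02 * x10 - x00 * x12];
     [:: x10 * x21 - x11 * x20; x01 * x20 - x00 * x21; x00 * x11 - x01 * x10]].
Proof.
apply/matrixP => i j; rewrite !mxE /cofactor.
by case: i => [[|[|[|]]]] //= hi; case: j => [[|[|[|]]]] //= hj;
  rewrite !(expand_det_row _ ord0) !big_ord_recl !big_ord0 /cofactor !det_mx11 !mxE /=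
    /bump /= ?addn0 ?expr0 ?expr1; ring.
Qed.

Lemma quat_of_SO3 x00 x01 x02 x10 x11 x12 x20 x21 x22 :
  let X := mx_of_rows 3 3
    [:: [:: x00; x01; x02]; [:: x10; x11; x12]; [:: x20; x21; x22]] in
  @SO R 3 X -> exists2 q, q != 0 & X = unit_quat_rot q.
Proof.
move=> X SX; have XXt := SO_mulVr SX; have [XX dX] := SX.
have adjX : \adj X = X^T.
  by rewrite -[LHS]mul1mx -XX -mulmxA mul_mx_adj dX mulmx1.
have e (A B : 'M[R]_3) : A = B -> forall i j, A i j = B i j by move=> ->.
(* The relations below say that columns and rows are orthonormal and that [X] is its own cofactor
   matrix. The later checks are linear in them, with products of entries as atoms. *)
have r0 : x00 * x00 + x10 * x10 + x20 * x20 = 1.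
  have := e _ _ XX (o 3 0) (o 3 0); rewrite !mxE !big_ord_recl big_ord0 !mxE /=; lra.
have r1 : x00 * x01 + x10 * x11 + x20 * x21 = 0.
  have := e _ _ XX (o 3 0) (o 3 1); rewrite !mxE !big_ord_recl big_ord0 !mxE /=; lra.
have r2 : x00 * x02 + x10 * x12 + x20 * x22 = 0.
  have := e _ _ XX (o 3 0) (o 3 2); rewrite !mxE !big_ord_recl big_ord0 !mxE /=; lra.
have r3 : x01 * x01 + x11 * x11 + x21 * x21 = 1.
  have := e _ _ XX (o 3 1) (o 3 1); rewrite !mxE !big_ord_recl big_ord0 !mxE /=; lra.
have r4 : x01 * x02 + x11 * x12 + x21 * x22 = 0.
  have := e _ _ XX (o 3 1) (o 3 2); rewrite !mxE !big_ord_recl big_ord0 !mxE /=; lra.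
have r5 : x02 * x02 + x12 * x12 + x22 * x22 = 1.
  have := e _ _ XX (o 3 2) (o 3 2); rewrite !mxE !big_ord_recl big_ord0 !mxE /=; lra.
have r6 : x00 * x00 + x01 * x01 + x02 * x02 = 1.
  have := e _ _ XXt (o 3 0) (o 3 0); rewrite !mxE !big_ord_recl big_ord0 !mxE /=; lra.
have r7 : x00 * x10 + x01 * x11 + x02 * x12 = 0.
  have := e _ _ XXt (o 3 0) (o 3 1); rewrite !mxE !big_ord_recl big_ord0 !mxE /=; lra.
have r8 : x00 * x20 + x01 * x21 + x02 * x22 = 0.
  have := e _ _ XXt (o 3 0) (o 3 2); rewrite !mxE !big_ord_recl big_ord0 !mxE /=; lra.
have r9 : x10 * x10 + x11 * x11 + x12 * x12 = 1.
  have := e _ _ XXt (o 3 1) (o 3 1); rewrite !mxE !big_ord_recl big_ord0 !mxE /=; lra.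
have r10 : x10 * x20 + x11 * x21 + x12 * x22 = 0.
  have := e _ _ XXt (o 3 1) (o 3 2); rewrite !mxE !big_ord_recl big_ord0 !mxE /=; lra.
have r11 : x20 * x20 + x21 * x21 + x22 * x22 = 1.
  have := e _ _ XXt (o 3 2) (o 3 2); rewrite !mxE !big_ord_recl big_ord0 !mxE /=; lra.
rewrite /X adj_rows3 in adjX.
have r12 : x00 = x11 * x22 - x12 * x21.
  by have := e _ _ adjX (o 3 0) (o 3 0); rewrite !mxE /=; lra.
have r13 : x01 = x12 * x20 - x10 * x22.
  by have := e _ _ adjX (o 3 1) (o 3 0); rewrite !mxE /=; lra.
have r14 : x02 = x10 * x21 - x11 * x20.
  by have := e _ _ adjX (o 3 2) (o 3 0); rewrite !mxE /=; lra.
have r15 : x10 = x02 * x21 - x01 * x22.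
  by have := e _ _ adjX (o 3 0) (o 3 1); rewrite !mxE /=; lra.
have r16 : x11 = x00 * x22 - x02 * x20.
  by have := e _ _ adjX (o 3 1) (o 3 1); rewrite !mxE /=; lra.
have r17 : x12 = x01 * x20 - x00 * x21.
  by have := e _ _ adjX (o 3 2) (o 3 1); rewrite !mxE /=; lra.
have r18 : x20 = x01 * x12 - x02 * x11.
  by have := e _ _ adjX (o 3 0) (o 3 2); rewrite !mxE /=; lra.
have r19 : x21 = x02 * x10 - x00 * x12.
  by have := e _ _ adjX (o 3 1) (o 3 2); rewrite !mxE /=; lra.
have r20 : x22 = x00 * x11 - x01 * x10.
  by have := e _ _ adjX (o 3 2) (o 3 2); rewrite !mxE /=; lra.
(* 1 + quat_form X is 4 q q^T for the unit quaternion q of X: its trace is 4, so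
   some diagonal entry k is nonzero, and the column through k is a multiple of q. *)
have main q k : k != 0 -> dot q q = 4 * k -> quat_rot q = 4 * k *: X ->
    exists2 q, q != 0 & X = unit_quat_rot q.
  move=> k0 qq qX; have k4 : 4 * k != 0 by rewrite mulf_neq0 // pnatr_eq0.
  exists q; last by rewrite /unit_quat_rot qq qX scalerA mulVf // scale1r.
  by apply: contra k4 => /eqP q0; rewrite -qq q0 dot0r.
clear XX XXt adjX dX SX e.
have [k0|k0] := eqVneq (1 + x00 + x11 + x22) 0; last first.
  apply: (main (mx_of_rows 4 1
    [:: [:: 1 + x00 + x11 + x22]; [:: x21 - x12]; [:: x02 - x20]; [:: x10 - x01]]) _ k0).
    by rewrite dot_rows4; lra.
  apply/matrixP => i j; rewrite !mxE /=.
  by case: i => [[|[|[|]]]] //= _; case: j => [[|[|[|]]]] //= _; lra.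
have [k1|k1] := eqVneq (1 + x00 - x11 - x22) 0; last first.
  apply: (main (mx_of_rows 4 1
    [:: [:: x21 - x12]; [:: 1 + x00 - x11 - x22]; [:: x01 + x10]; [:: x02 + x20]]) _ k1).
    by rewrite dot_rows4; lra.
  apply/matrixP => i j; rewrite !mxE /=.
  by case: i => [[|[|[|]]]] //= _; case: j => [[|[|[|]]]] //= _; lra.
have [k2|k2] := eqVneq (1 + x11 - x00 - x22) 0; last first.
  apply: (main (mx_of_rows 4 1
    [:: [:: x02 - x20]; [:: x01 + x10]; [:: 1 + x11 - x00 - x22]; [:: x12 + x21]]) _ k2).
    by rewrite dot_rows4; lra.
  apply/matrixP => i j; rewrite !mxE /=.
  by case: i => [[|[|[|]]]] //= _; case: j => [[|[|[|]]]] //= _; lra.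
have [k3|k3] := eqVneq (1 + x22 - x00 - x11) 0; last first.
  apply: (main (mx_of_rows 4 1
    [:: [:: x10 - x01]; [:: x02 + x20]; [:: x12 + x21]; [:: 1 + x22 - x00 - x11]]) _ k3).
    by rewrite dot_rows4; lra.
  apply/matrixP => i j; rewrite !mxE /=.
  by case: i => [[|[|[|]]]] //= _; case: j => [[|[|[|]]]] //= _; lra.
lra.
Qed.

End Quaternion.

Lemma connected_level_SO3 (R : realType) (A : 'M[R]_3) c :
  connected (@SO R 3 `&` [set X | mxinner A X = c]).
Proof.
(* Multiplying the level equation by [dot q q] makes it homogeneous: it becomes the vanishing of the
   quadratic form of [M]. *)
pose M := quat_form A - c%:M.
have levelE q : q != 0 -> (mxinner A (unit_quat_rot q) == c) = (dot q (M *m q) == 0).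
  move=> q0; have qq : dot q q != 0 by apply: contra q0 => /eqP/dot_eq0 ->.
  rewrite /M mulmxBl mul_scalar_mx -scaleNr dotDr dotZr -mxinner_quat_rot.
  have -> : mxinner A (unit_quat_rot q) = (dot q q)^-1 * mxinner A (quat_rot q).
    by rewrite /mxinner /unit_quat_rot -scalemxAr mxtraceZ.
  by rewrite mulNr subr_eq0 -(inj_eq (mulfI qq)) mulrA mulfV // mul1r mulrC.
have Msym : M^T = M by rewrite /M linearB /= quat_form_sym tr_scalar_mx.
have := connected_quadric Msym (@continuous_unit_quat_rot R) (@unit_quat_rotZ R).
congr connected; apply/seteqP; split => [_ [q [q0 /eqP Mq] <-]|X [SX /eqP AX]].
  by split; [exact: SO_unit_quat_rot|apply/eqP; rewrite levelE].
have [x00 [x01 [x02 [x10 [x11 [x12 [x20 [x21 [x22 EX]]]]]]]]] := mx3_rows X.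
rewrite EX in SX AX *.
have [q q0 Xq] := quat_of_SO3 SX.
by exists q => //; split => //; apply/eqP; rewrite -levelE // -Xq.
Qed.

Unset Implicit Arguments.
Set Strict Implicit.
Set Printing Implicit Defensive.

Theorem theorem3 (R : realType) (n : nat) (hn : (3 <= n)%N)
    (A : 'M[R]_n) (c : R) :
  connected (@SO R n `&` [set X : 'M[R]_n | mxinner A X = c]).
Proof.
move: A c; rewrite -(subnKC hn); elim: (n - 3)%N => [|k IH] A c.
  exact: connected_level_SO3.
by apply: (@connected_level_step R k).
Qed.
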